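(* There exists a $6$-regular distance magic graph $G$ of order $27$ such that $$\dim_{\mathbb F_3}\ker\overline A_3=2 .$$ Consequently, for $\Gamma=(\mathbb Z/3\mathbb Z)^3$, this graph $G$ admits a generating $\Gamma$-magic map but no affinely generating $\Gamma$-magic map. In particular, $G$ is not $\Gamma$-distance magic and hence is not group distance magic.
   Context: Graphs are finite, simple and undirected; $N_G(v)$ is the open neighborhood of $v$. A graph $G$ of order $N$ is distance magic if there is a bijection $\ell\colon V(G)\to\{1,\dots,N\}$ such that the integer $\sum_{u\in N_G(v)}\ell(u)$ is the same for all $v$. For a finite abelian group $\Gamma$ (written additively), a map $f\colon V(G)\to\Gamma$ is a $\Gamma$-magic map if there is $\gamma\in\Gamma$ with $\sum_{u\in N_G(v)}f(u)=\gamma$ for every $v\in V(G)$. It is generating if $\langle f(v)\mid v\in V(G)\rangle=\Gamma$, and affinely generating if $\langle f(v)-f(w)\mid v,w\in V(G)\rangle=\Gamma$. $G$ is $\Gamma$-distance magic if it admits a bijective $\Gamma$-magic map (so $|V(G)|=|\Gamma|$). A graph of order $N$ is group distance magic if it is $\Gamma$-distance magic for every abelian group $\Gamma$ of order $N$. For a regular graph $G$ with adjacency matrix $A$ and $m\ge1$, $\overline A_m$ is the endomorphism $[x]\mapsto[Ax]$ of the quotient $(\mathbb Z/m\mathbb Z)^{V(G)}/(\mathbb Z/m\mathbb Z)\mathbf 1$, where $\mathbf 1$ is the all-one vector (well defined because $A\mathbf 1$ is a multiple of $\mathbf 1$). *)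

(* Defs.v *)
From HB Require Import structures.
From mathcomp Require Import all_boot all_order all_algebra all_fingroup.
From mathcomp Require Import ring_quotient generic_quotient.

Set Implicit Arguments.
Unset Strict Implicit.
Unset Printing Implicit Defensive.

Import GRing.Theory.
Local Open Scope ring_scope.
Local Open Scope quotient_scope.

Record sgraph := SGraph {
  vertex :> finType;
  adj : rel vertex;
  adj_sym : symmetric adj;
  adj_irrefl : irreflexive adj
}.

Definition regular (G : sgraph) (k : nat) : Prop :=
  forall v : G, #|[set u | adj v u]| = k.

(* The label of [u] is [(l u).+1], as ['I_N] is {0, ..., N - 1}. *)
Definition distance_magic (G : sgraph) : Prop :=
  exists l : G -> 'I_#|G|,
    bijective l /\
    exists c : nat, forall v : G, (\sum_(u | adj v u) (l u).+1)%N = c.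

Section MagicMaps.
Variables (G : sgraph) (Gamma : finZmodType).

Definition magic_map (f : G -> Gamma) : Prop :=
  exists c : Gamma, forall v : G, \sum_(u | adj v u) f u = c.

(* [<<_>>] is the subgroup generated in the additive group [Gamma]. *)
Definition generating (f : G -> Gamma) : Prop :=
  <<[set f v | v : G]>>%g = [set: Gamma].

Definition affinely_generating (f : G -> Gamma) : Prop :=
  <<[set f v - f w | v : G, w : G]>>%g = [set: Gamma].

Definition Gamma_distance_magic : Prop :=
  exists f : G -> Gamma, bijective f /\ magic_map f.

End MagicMaps.

Definition group_distance_magic (G : sgraph) : Prop :=
  forall Gamma : finZmodType, #|Gamma| = #|G| -> Gamma_distance_magic G Gamma.

Section ConstQuotient.
Variables (R : comNzRingType) (T : finType).
Implicit Types x y : {ffun T -> R^o}.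

(* The multiples of the all-one vector are the constant vectors; this form is
   decidable over any ring of coefficients (see [const_vecP]). *)
Definition const_vec : {pred {ffun T -> R^o}} :=
  fun x => [forall u, forall v, x u == x v].

Lemma const_vecE x :
  reflect (forall u v, x u = x v) (x \in const_vec).
Proof.
apply: (iffP forallP) => [h u v|h u]; last by apply/forallP=> v; apply/eqP.
by move/forallP: (h u) => /(_ v)/eqP.
Qed.

Lemma const_vecP x :
  reflect (exists c : R, x = c *: [ffun=> 1]) (x \in const_vec).
Proof.
apply: (iffP (const_vecE x)) => [h|[c ->] u v]; last by rewrite !ffunE.
case: (pickP T) => [v0 _|T0]; [exists (x v0) | exists 0]; apply/ffunP=> u.
  by rewrite !ffunE (h u v0) /GRing.scale /= mulr1.
by have := T0 u.
Qed.

Fact const_vec_zmod_closed : zmod_closed const_vec.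
Proof.
split; first by apply/const_vecE=> u v; rewrite !ffunE.
by move=> x y /const_vecE hx /const_vecE hy; apply/const_vecE=> u v;
  rewrite !ffunE (hx u v) (hy u v).
Qed.
HB.instance Definition _ :=
  GRing.isZmodClosed.Build _ const_vec const_vec_zmod_closed.

Lemma const_vecZ a x : x \in const_vec -> a *: x \in const_vec.
Proof.
by move=> /const_vecE hx; apply/const_vecE=> u v; rewrite !ffunE (hx u v).
Qed.

(* The module R^T / R 1; R = 'F_3 gives (Z/3Z)^T / (Z/3Z)1. *)
Definition cquot :=
  @Quotient.quot {ffun T -> R^o} (GRing.ZmodClosed.clone _ const_vec _).
HB.instance Definition _ := Choice.on cquot.
HB.instance Definition _ := GRing.Zmodule.on cquot.
HB.instance Definition _ := ZmodQuotient.on cquot.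

Lemma cquot_eq (x y : {ffun T -> R^o}) :
  (\pi_cquot x = \pi_cquot y) <-> (x - y \in const_vec).
Proof. by rewrite Quotient.idealrBE; split=> [->|/eqP]. Qed.

Definition cquot_scale (a : R) (q : cquot) : cquot :=
  \pi_cquot (a *: repr q).

Lemma pi_cquot_scale a x : cquot_scale a (\pi x) = \pi_cquot (a *: x).
Proof.
apply/cquot_eq; rewrite -scalerBr; apply: const_vecZ.
by apply/cquot_eq; rewrite reprK.
Qed.

Lemma pi_cquotD (x y : {ffun T -> R^o}) :
  \pi_cquot (x + y) = \pi_cquot x + \pi_cquot y.
Proof. exact: raddfD. Qed.

Fact cquot_scaleA a b q :
  cquot_scale a (cquot_scale b q) = cquot_scale (a * b) q.
Proof.
by elim/quotW: q => x; rewrite (pi_cquot_scale b x) !pi_cquot_scale scalerA.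
Qed.

Fact cquot_scale1 : left_id 1 cquot_scale.
Proof. by elim/quotW=> x; rewrite pi_cquot_scale scale1r. Qed.

Fact cquot_scaleDr : right_distributive cquot_scale +%R.
Proof.
move=> a; elim/quotW=> x; elim/quotW=> y; rewrite -pi_cquotD !pi_cquot_scale.
by rewrite scalerDr pi_cquotD.
Qed.

Fact cquot_scaleDl q : {morph cquot_scale^~ q : a b / a + b}.
Proof.
by elim/quotW: q => x a b /=; rewrite !pi_cquot_scale scalerDl pi_cquotD.
Qed.

HB.instance Definition _ := GRing.Zmodule_isLmodule.Build R cquot
  cquot_scaleA cquot_scale1 cquot_scaleDr cquot_scaleDl.

Lemma pi_cquotZ a (x : {ffun T -> R^o}) :
  \pi_cquot (a *: x) = a *: \pi_cquot x.
Proof. by rewrite -pi_cquot_scale. Qed.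

(* Coordinates on R^T / R 1: differences with the value at a base point. *)
Let pt : option T := [pick u : T].
Let idx : pred T := fun u => Some u != pt.
Let val0 (x : {ffun T -> R^o}) : R := oapp x 0 pt.
Let coords (x : {ffun T -> R^o}) : 'rV[R]_#|idx| :=
  \row_i (x (enum_val i) - val0 x).

Let val0_linear a x y : val0 (a *: x + y) = a * val0 x + val0 y.
Proof.
rewrite /val0; case: pt => [v|] /=; first by rewrite !ffunE.
by rewrite mulr0 addr0.
Qed.

Let coords_linear a x y : coords (a *: x + y) = a *: coords x + coords y.
Proof.
apply/rowP=> i; rewrite !mxE val0_linear !ffunE /GRing.scale /=.
by rewrite mulrBr opprD addrACA.
Qed.

Let pt_ex (u : T) : exists v0, pt = Some v0.
Proof. by rewrite /pt; case: pickP => [v0 _|/(_ u)//]; exists v0. Qed.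

Let val0E x v : pt = Some v -> val0 x = x v.
Proof. by rewrite /val0 => ->. Qed.

Let coords_ker x : (coords x == 0) = (x \in const_vec).
Proof.
apply/eqP/const_vecE => [/rowP c0|h].
  suff E u : x u = val0 x by move=> u v; rewrite !E.
  case: (boolP (idx u)) => [iu|]; last by rewrite negbK /val0 => /eqP<-.
  have := c0 (enum_rank_in iu u).
  by rewrite !mxE enum_rankK_in // => /eqP; rewrite subr_eq0 => /eqP.
apply/rowP=> i; rewrite !mxE; have [v0 e] := pt_ex (enum_val i).
by rewrite (val0E _ e) (h (enum_val i) v0) subrr.
Qed.

Let lift_coords (w : 'rV[R]_#|idx|) : {ffun T -> R^o} :=
  [ffun u => \sum_(i | enum_val i == u) w 0 i].

Let lift_coordsK : cancel lift_coords coords.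
Proof.
move=> w; apply/rowP=> i; rewrite !mxE !ffunE.
rewrite (big_pred1 i) => [|j]; last by rewrite (inj_eq enum_val_inj).
have [v e] := pt_ex (enum_val i).
rewrite (val0E _ e) ffunE big_pred0 ?subr0 // => j; apply/negbTE/eqP=> ejv.
by have := enum_valP j; rewrite ejv unfold_in /idx e eqxx.
Qed.

Let qcoords (q : cquot) := coords (repr q).

Let coordsB x y : coords (x - y) = coords x - coords y.
Proof.
by have := coords_linear (-1) y x; rewrite !scaleN1r ![- _ + _]addrC.
Qed.

Let qcoords_pi x : qcoords (\pi x) = coords x.
Proof.
apply/eqP; rewrite -subr_eq0 -coordsB coords_ker.
by apply/cquot_eq; rewrite reprK.
Qed.

Fact cquot_vect_iso : Vector.axiom #|idx| cquot.
Proof.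
exists qcoords.
  move=> a q r; rewrite -[q]reprK -[r]reprK -pi_cquotZ -pi_cquotD !qcoords_pi.
  exact: coords_linear.
exists (fun w => \pi_cquot (lift_coords w)) => [q|w]; last first.
  by rewrite qcoords_pi lift_coordsK.
rewrite -[q in RHS]reprK; apply/cquot_eq.
by rewrite -coords_ker coordsB lift_coordsK subrr.
Qed.
HB.instance Definition _ := Lmodule_hasFinDim.Build R cquot cquot_vect_iso.

End ConstQuotient.

(* x |-> A x for the adjacency matrix A. *)
Definition adj_op (R : comNzRingType) (G : sgraph) (x : {ffun G -> R^o}) :
    {ffun G -> R^o} :=
  [ffun v => \sum_(u | adj v u) x u].

Section AdjBar.
Variables (R : comNzRingType) (G : sgraph) (k : nat) (regG : regular G k).

(* The endomorphism [x] |-> [A x] of R^G / R 1; it is well defined and linear by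
   regularity, which is why [regG] is an argument. *)
Definition adj_bar & regular G k : cquot R G -> cquot R G :=
  fun q => \pi_(cquot R G) (adj_op (repr q)).

Lemma adj_op_const (x : {ffun G -> R^o}) :
  x \in @const_vec R G -> adj_op x \in @const_vec R G.
Proof.
case/const_vecP=> c ->; apply/const_vecE=> u v; rewrite !ffunE.
have E (w : G) :
    \sum_(i | adj w i) (c *: [ffun=> 1] : {ffun G -> R^o}) i = c *+ k.
  rewrite (eq_bigr (fun=> c)) => [|i _]; last first.
    by rewrite !ffunE /GRing.scale /= mulr1.
  by rewrite sumr_const -(regG w) cardsE.
by rewrite !E.
Qed.

Lemma adj_op_linear a (x y : {ffun G -> R^o}) :
  adj_op (a *: x + y) = a *: adj_op x + adj_op y.
Proof.
apply/ffunP=> v; rewrite !ffunE scaler_sumr -big_split /=.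
by apply: eq_bigr=> u _; rewrite !ffunE.
Qed.

Lemma adj_bar_pi (x : {ffun G -> R^o}) :
  adj_bar regG (\pi x) = \pi_(cquot R G) (adj_op x).
Proof.
apply/cquot_eq; rewrite -[_ - _]addrC -scaleN1r -adj_op_linear.
apply: adj_op_const; rewrite scaleN1r addrC.
by apply/cquot_eq; rewrite reprK.
Qed.

Fact adj_bar_linear : linear (adj_bar regG).
Proof.
move=> a; elim/quotW=> x; elim/quotW=> y; rewrite -pi_cquotZ -pi_cquotD !adj_bar_pi.
by rewrite adj_op_linear pi_cquotD pi_cquotZ.
Qed.

HB.instance Definition _ :=
  GRing.isLinear.Build R (cquot R G) (cquot R G) _ (adj_bar regG)
    adj_bar_linear.

End AdjBar.

(* Main.v *)
(** Let A be the adjacency matrix of a distance magic 6-regular graph on the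
    vertices 0, ..., 26, with label v + 1 at v.  Modulo 3, the kernel of A
    contains the all-one vector 1 and the vector v |-> v; the graph below is
    chosen so that they span it.  Since A is symmetric and 1 is orthogonal to
    both, A x = 1 has a solution y.  Hence every magic map f into a group of
    exponent 3, with magic constant c, has the form
      f v = f 0 + v (f 1 - f 0) + y_v c,
    so its differences lie in the subgroup generated by f 1 - f 0 and c, which
    has at most 9 elements, while v |-> (1, v, y_v) is magic and generating.
    With coefficients in F_3 the same formula says that the classes of v |-> v
    and y form a basis of the kernel on F_3^V / F_3 1. *)

Require Import Defs.
From mathcomp Require Import all_boot all_order all_algebra all_fingroup.
From mathcomp Require Import ssrAC cyclic zify.

Local Open Scope ring_scope.

Import GRing.Theory.

(** * The graph and a left inverse of its adjacency matrix modulo 3 *)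

(* Found by computer search; vertex [v] carries the label [v + 1]. *)
Definition neighbors : seq (seq nat) := [::
  [:: 1; 3; 9; 19; 21; 25];
  [:: 0; 2; 10; 18; 22; 26];
  [:: 1; 5; 11; 16; 21; 24];
  [:: 0; 8; 12; 13; 19; 26];
  [:: 5; 6; 7; 18; 19; 23];
  [:: 2; 4; 10; 14; 23; 25];
  [:: 4; 7; 13; 14; 15; 25];
  [:: 4; 6; 9; 16; 17; 26];
  [:: 3; 11; 13; 15; 16; 20];
  [:: 0; 7; 12; 14; 22; 23];
  [:: 1; 5; 11; 17; 20; 24];
  [:: 2; 8; 10; 15; 21; 22];
  [:: 3; 9; 14; 15; 17; 20];
  [:: 3; 6; 8; 18; 20; 23];
  [:: 5; 6; 9; 12; 22; 24];
  [:: 6; 8; 11; 12; 17; 24];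
  [:: 2; 7; 8; 17; 20; 24];
  [:: 7; 10; 12; 15; 16; 18];
  [:: 1; 4; 13; 17; 21; 22];
  [:: 0; 3; 4; 20; 25; 26];
  [:: 8; 10; 12; 13; 16; 19];
  [:: 0; 2; 11; 18; 23; 24];
  [:: 1; 9; 11; 14; 18; 25];
  [:: 4; 5; 9; 13; 21; 26];
  [:: 2; 10; 14; 15; 16; 21];
  [:: 0; 5; 6; 19; 22; 26];
  [:: 1; 3; 7; 19; 23; 25]].

(* Obtained by Gaussian elimination modulo 3, with columns 0 and 1 free; the
   property it certifies is [left_inv_adj]. *)
Definition left_inverse_table : seq (seq nat) := [::
  [:: 0; 0; 0; 0; 0; 0; 0; 0; 0; 0; 0; 0; 0; 0; 0; 0; 0; 0; 0; 0; 0; 0; 0; 0; 0; 0; 0];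
  [:: 0; 0; 0; 0; 0; 0; 0; 0; 0; 0; 0; 0; 0; 0; 0; 0; 0; 0; 0; 0; 0; 0; 0; 0; 0; 0; 0];
  [:: 2; 2; 0; 1; 0; 2; 2; 0; 2; 1; 1; 1; 0; 1; 0; 2; 1; 2; 2; 1; 0; 2; 2; 2; 2; 0; 0];
  [:: 2; 2; 1; 2; 1; 1; 0; 0; 0; 1; 2; 1; 1; 2; 2; 1; 2; 2; 0; 2; 1; 1; 1; 0; 2; 0; 0];
  [:: 1; 0; 0; 0; 0; 1; 1; 0; 0; 1; 1; 2; 2; 1; 1; 1; 0; 1; 2; 2; 2; 0; 1; 1; 0; 0; 0];
  [:: 2; 2; 2; 1; 1; 0; 0; 0; 1; 1; 0; 1; 0; 2; 2; 1; 2; 2; 0; 1; 2; 2; 0; 2; 2; 0; 0];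
  [:: 1; 1; 1; 2; 1; 2; 0; 1; 0; 0; 1; 2; 2; 2; 2; 1; 0; 2; 1; 1; 2; 1; 2; 1; 0; 0; 0];
  [:: 0; 1; 0; 1; 1; 0; 0; 0; 1; 2; 0; 0; 1; 1; 1; 0; 0; 1; 2; 0; 1; 2; 0; 1; 0; 0; 0];
  [:: 2; 0; 1; 0; 1; 0; 1; 2; 1; 2; 1; 1; 1; 0; 1; 2; 1; 1; 2; 2; 0; 0; 1; 2; 1; 0; 0];
  [:: 1; 0; 1; 0; 0; 1; 0; 2; 2; 0; 2; 1; 1; 1; 0; 0; 2; 1; 2; 1; 2; 1; 0; 0; 1; 0; 0];
  [:: 1; 0; 1; 1; 1; 0; 1; 2; 0; 0; 1; 1; 1; 2; 2; 2; 0; 1; 0; 2; 0; 0; 2; 1; 2; 0; 0];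
  [:: 2; 1; 2; 1; 1; 2; 0; 2; 0; 1; 0; 1; 2; 0; 0; 0; 2; 2; 0; 2; 2; 2; 0; 0; 1; 0; 0];
  [:: 2; 2; 0; 1; 0; 0; 0; 0; 1; 2; 2; 2; 1; 0; 0; 0; 0; 1; 0; 2; 0; 1; 2; 1; 1; 0; 0];
  [:: 0; 2; 0; 0; 0; 1; 1; 2; 1; 1; 1; 0; 1; 1; 0; 0; 2; 2; 0; 0; 0; 0; 1; 2; 1; 0; 0];
  [:: 2; 1; 1; 2; 0; 0; 0; 0; 0; 0; 1; 0; 0; 0; 2; 1; 1; 2; 0; 1; 2; 0; 0; 2; 1; 0; 0];
  [:: 0; 1; 2; 2; 1; 1; 0; 1; 2; 2; 2; 0; 1; 1; 1; 2; 1; 2; 2; 2; 0; 1; 0; 0; 2; 0; 0];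
  [:: 2; 2; 1; 2; 2; 2; 1; 1; 0; 1; 2; 0; 0; 2; 2; 2; 0; 2; 1; 2; 0; 2; 2; 2; 0; 0; 0];
  [:: 1; 1; 1; 1; 0; 1; 2; 0; 1; 0; 0; 0; 0; 2; 0; 1; 1; 0; 2; 2; 1; 0; 0; 2; 0; 0; 0];
  [:: 1; 0; 2; 2; 1; 0; 1; 2; 2; 2; 2; 0; 2; 0; 0; 0; 2; 0; 1; 1; 2; 0; 0; 1; 1; 0; 0];
  [:: 2; 0; 0; 2; 2; 0; 2; 2; 0; 0; 2; 2; 2; 1; 1; 0; 0; 2; 0; 1; 1; 0; 1; 1; 1; 0; 0];
  [:: 0; 1; 0; 2; 1; 2; 1; 0; 1; 0; 2; 1; 1; 0; 1; 1; 2; 2; 0; 1; 0; 0; 2; 2; 0; 0; 0];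
  [:: 2; 0; 1; 1; 2; 1; 2; 2; 2; 2; 2; 1; 1; 0; 2; 0; 0; 0; 1; 1; 1; 1; 0; 2; 0; 0; 0];
  [:: 2; 0; 1; 1; 1; 2; 0; 2; 2; 2; 2; 0; 2; 2; 0; 1; 0; 0; 2; 1; 2; 2; 1; 2; 2; 0; 0];
  [:: 0; 2; 1; 1; 1; 1; 0; 1; 2; 1; 1; 1; 2; 0; 0; 1; 2; 2; 2; 2; 1; 1; 0; 0; 2; 0; 0];
  [:: 1; 1; 1; 1; 0; 1; 0; 1; 0; 1; 2; 0; 0; 2; 0; 0; 2; 0; 1; 0; 1; 2; 1; 0; 0; 0; 0];
  [:: 0; 1; 0; 1; 1; 0; 2; 0; 2; 0; 1; 1; 1; 2; 1; 2; 2; 1; 0; 1; 1; 0; 1; 0; 2; 0; 0];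
  [:: 0; 2; 2; 1; 0; 2; 2; 0; 0; 1; 0; 1; 1; 1; 1; 1; 0; 0; 1; 1; 2; 2; 1; 0; 2; 0; 0]].

Definition adjn (u v : nat) : bool := v \in nth [::] neighbors u.

Definition left_inv (v u : nat) : nat :=
  nth 0%N (nth [::] left_inverse_table v) u.

(* The left inverse applied to 1 is the solution of A x = 1 modulo 3 with
   x_0 = x_1 = 0. *)
Definition sol1 (v : nat) : nat := sumn (nth [::] left_inverse_table v).

(** Quantification as a boolean on [nat], so that [vm_compute] decides statements about all
    vertices. *)
Definition below (n : nat) (P : pred nat) : bool := all P (iota 0 n).

Lemma belowP {n P} : below n P -> forall i : 'I_n, P i.
Proof. by move=> /allP h i; apply: h; rewrite mem_iota /=. Qed.

Lemma below2P {n} {P : rel nat} :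
  below n (fun i => below n (P i)) -> forall i j : 'I_n, P i j.
Proof. by move=> h i j; apply: (belowP (belowP h i)). Qed.

(** Big operators are locked and do not reduce, whereas [sumn] evaluates under [vm_compute]. *)
Lemma sum_ord_sumn n (F : nat -> nat) :
  (\sum_(i < n) F i)%N = sumn [seq F i | i <- iota 0 n].
Proof. by rewrite sumnE big_map -(big_mkord xpredT) /index_iota subn0. Qed.

(** * Regularity and the magic labelling *)

Definition adj27 : rel 'I_27 := fun u v => adjn u v.

Lemma adj27_sym : symmetric adj27.
Proof.
move=> u v; apply/eqP; move: u v.
by apply: (@below2P 27 (fun u v => adjn u v == adjn v u)); vm_compute.
Qed.

Lemma adj27_irrefl : irreflexive adj27.
Proof.
move=> u; apply/negbTE; move: u.
by apply: (@belowP 27 (fun u => ~~ adjn u u)); vm_compute.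
Qed.

Definition G27 : sgraph := SGraph adj27_sym adj27_irrefl.

Lemma nbr_sumE (F : nat -> nat) (v : G27) :
  (\sum_(u | adj v u) F u)%N = sumn [seq adjn v u * F u | u <- iota 0 27]%N.
Proof.
rewrite -sum_ord_sumn big_mkcond; apply: eq_bigr => u _.
by rewrite /= /adj27; case: adjn; rewrite ?mul1n.
Qed.

Lemma nbr_sum_eq (F : nat -> nat) c :
  below 27 (fun v => sumn [seq adjn v u * F u | u <- iota 0 27] == c)%N ->
  forall v : G27, (\sum_(u | adj v u) F u)%N = c.
Proof. by move=> h v; rewrite nbr_sumE (eqP (belowP h v)). Qed.

Lemma nbr_sum_mod3 (F : nat -> nat) c :
  below 27 (fun v =>
    sumn [seq adjn v u * F u | u <- iota 0 27] == c %[mod 3])%N ->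
  forall v : G27, (\sum_(u | adj v u) F u = c %[mod 3])%N.
Proof. by move=> h v; rewrite nbr_sumE (eqP (belowP h v)). Qed.

Lemma nbr_sum1 (v : G27) : (\sum_(u | adj v u) 1)%N = 6%N.
Proof. by move: v; apply: (nbr_sum_eq (fun=> 1%N)); vm_compute. Qed.

Lemma G27_regular : regular G27 6.
Proof. by move=> v; rewrite cardsE -sum1_card; apply: nbr_sum1. Qed.

Lemma card_G27 : #|G27| = 27%N.
Proof. exact: card_ord. Qed.

Lemma G27_distance_magic : distance_magic G27.
Proof.
exists (cast_ord (esym card_G27)); split.
  by exists (cast_ord card_G27); [apply: cast_ordKV | apply: cast_ordK].
(* Six neighbors, and the labels 1 to 27 have average 14. *)
by exists 84%N; apply: (nbr_sum_eq S); vm_compute.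
Qed.

(** * Kernel vectors and the left inverse modulo 3 *)

Lemma nbr_sum_id (v : G27) : (\sum_(u | adj v u) (u : nat) = 0 %[mod 3])%N.
Proof. by move: v; apply: (nbr_sum_mod3 id); vm_compute. Qed.

Lemma nbr_sum_sol1 (v : G27) : (\sum_(u | adj v u) sol1 u = 1 %[mod 3])%N.
Proof. by move: v; apply: (nbr_sum_mod3 sol1); vm_compute. Qed.

Definition v0 : G27 := @Ordinal 27 0 isT.
Definition v1 : G27 := @Ordinal 27 1 isT.
Definition v2 : G27 := @Ordinal 27 2 isT.

Lemma sol1_v0 : sol1 v0 = 0%N. Proof. by []. Qed.

Lemma sol1_v1 : sol1 v1 = 0%N. Proof. by []. Qed.

Lemma sol1_v2 : (sol1 v2 = 1 %[mod 3])%N. Proof. by []. Qed.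

(** Modulo 3, [v + 2] is v - 1 and [v + v] is -v. So row v of this product sends f to f v - f 0 - v
    (f 1 - f 0): it recovers f up to the kernel vector that agrees with f at 0 and 1. *)
Lemma left_inv_adj (v w : G27) :
  (\sum_(u < 27) left_inv v u * adjn u w =
    (v == w) + (w == v0) * (v + 2) + (w == v1) * (v + v) %[mod 3])%N.
Proof.
rewrite (sum_ord_sumn 27 (fun u => left_inv v u * adjn u w))%N; apply/eqP.
move: v w; apply: (@below2P 27 (fun v w =>
  sumn [seq left_inv v u * adjn u w | u <- iota 0 27] ==
    (v == w) + (w == 0) * (v + 2) + (w == 1) * (v + v) %[mod 3])%N).
by vm_compute.
Qed.

Lemma sum_left_inv (v : G27) : (\sum_(u < 27) left_inv v u)%N = sol1 v.
Proof.
rewrite (sum_ord_sumn 27 (left_inv v)); apply/eqP; move: v.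
by apply: (@belowP 27 (fun v =>
  sumn [seq left_inv v u | u <- iota 0 27] == sol1 v)); vm_compute.
Qed.

(** * Magic maps into groups of exponent 3 *)

Section Exponent3.
Variables (V : zmodType) (V3 : forall x : V, x *+ 3 = 0).

Lemma mulrn_mod3 (x : V) m n : (m = n %[mod 3])%N -> x *+ m = x *+ n.
Proof.
move=> e; rewrite (divn_eq m 3) (divn_eq n 3) e !mulrnDr.
by rewrite [(m %/ 3 * 3)%N]mulnC [(n %/ 3 * 3)%N]mulnC !mulrnA !V3 !mul0rn.
Qed.

(** Apply the left inverse to A f = c 1: the right side becomes c times its row sums [sol1], and
    [left_inv_adj] evaluates the left side. Natural number entries act through [*+], so [V] needs no
    ring structure. *)
Lemma magic_map_coords (f : G27 -> V) c :
    (forall v, \sum_(u | adj v u) f u = c) ->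
  forall v : G27, f v = f v0 + (f v1 - f v0) *+ v + c *+ sol1 v.
Proof.
move=> fc v.
have : \sum_(u < 27) (\sum_(w | adj (u : G27) w) f w) *+ left_inv v u =
       c *+ sol1 v.
  by rewrite -sum_left_inv -sumrMnr; apply: eq_bigr => u _; rewrite fc.
have -> : \sum_(u < 27) (\sum_(w | adj (u : G27) w) f w) *+ left_inv v u =
          \sum_(w : G27) f w *+ (\sum_(u < 27) left_inv v u * adjn u w)%N.
  under eq_bigr => u _ do rewrite -sumrMnl big_mkcond.
  rewrite exchange_big; apply: eq_bigr => w _; rewrite -sumrMnr.
  apply: eq_bigr => u _; rewrite /= /adj27.
  by case: adjn; rewrite ?muln1 ?muln0.
under eq_bigr => w _ do rewrite (mulrn_mod3 _ _ _ (left_inv_adj v w)) !mulrnDr.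
rewrite !big_split /=.
rewrite (bigD1 v) //= big1 ?eqxx ?addr0; last first.
  by move=> w; rewrite eq_sym => /negbTE->.
rewrite (bigD1 v0) //= big1 ?eqxx ?addr0; last first.
  by move=> w /negbTE->.
rewrite (bigD1 v1) //= big1 ?eqxx ?addr0; last first.
  by move=> w /negbTE->.
move=> <-; rewrite !mul1n mulr1n mulrnBl.
rewrite !mulrnDr mulr2n !addrA.
(* Collect f v, 3 (f v0), 3 v (f v1) and v (f v0) - v (f v0). *)
rewrite [RHS](ACl (4*(1*6*7)*(2*8*9)*(3*5)))/=.
have add3 x : x + x + x = 0 :> V by rewrite -(V3 x) !mulrS addr0 addrA.
by rewrite !add3 addNr !addr0.
Qed.

End Exponent3.

Lemma not_affinely_generating (V : finZmodType) (f : G27 -> V) :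
  (forall x : V, x *+ 3 = 0) -> (9 < #|V|)%N ->
  magic_map f -> ~ affinely_generating f.
Proof.
move=> V3 Vgt9 [c /(magic_map_coords V V3) fE] gen_f.
set d := f v1 - f v0 in fE.
have leq_order3 (x : V) : (#[x]%g <= 3)%N.
  by apply: dvdn_leq => //; rewrite order_dvdn FinRing.zmodXgE V3.
(* Commutation turns the join into a product set, whose size is at most the product of the two
   orders. *)
have cdC : commute <[d]>%g <[c]>%g.
  apply: normC; apply: cents_norm; rewrite cent_cycle cycle_subG.
  by apply/cent1P; rewrite /commute !FinRing.zmodMgE addrC.
have sub : [set: V] \subset (<[d]> <*> <[c]>)%g.
  rewrite -gen_f gen_subG; apply/subsetP => x /imset2P[v w _ _ ->].
  (* Differences with the base value [f v0] suffice: any other difference is a quotient of two of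
     them. *)
  have mem (u : G27) : (f u - f v0)%R \in (<[d]> <*> <[c]>)%g.
    rewrite (fE u) -[f v0 + _ + _]addrA addrAC subrr add0r.
    rewrite -!FinRing.zmodXgE -FinRing.zmodMgE.
    by rewrite comm_joingE //; apply: mem_mulg; apply: mem_cycle.
  have -> : f v - f w = ((f v - f v0)%R * (f w - f v0)%R^-1)%g.
    by rewrite FinRing.zmodMgE FinRing.zmodVgE opprB addrA subrK.
  by rewrite groupM ?groupV ?mem.
have := subset_leq_card sub; rewrite cardsT comm_joingE // => leV.
have le9 : (#|(<[d]> * <[c]>)%g| <= #[d]%g * #[c]%g)%N.
  by rewrite mul_cardG leq_pmulr ?cardG_gt0.
have := leq_trans le9 (leq_mul (leq_order3 d) (leq_order3 c)).
by move=> /(leq_trans leV); rewrite leqNgt Vgt9.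
Qed.

(** Both x and 0 are values of a bijection, so x = x - 0 is itself a difference of values. *)
Lemma bijective_affinely_generating (G : sgraph) (V : finZmodType)
  (f : G -> V) : bijective f -> affinely_generating f.
Proof.
case=> g _ gK; apply/eqP; rewrite eqEsubset subsetT /=.
apply/subsetP => x _; apply: mem_gen; apply/imset2P.
by exists (g x) (g 0) => //; rewrite !gK subr0.
Qed.

(** * A generating magic map into (Z/3Z)^3 *)

Lemma Z3_exponent (x : 'Z_3) : x *+ 3 = 0.
Proof. by case: x => [[|[|[|m]]] lt_m] //; apply: val_inj. Qed.

Lemma Z3_row_exponent (x : 'rV['Z_3]_3) : x *+ 3 = 0.
Proof. by apply/rowP => i; rewrite mulmxnE mxE Z3_exponent. Qed.

(** The constant coordinate helps to generate the group but vanishes in all differences. *)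
Definition coord_map (v : G27) : 'rV['Z_3]_3 :=
  \row_j (nth 0%N [:: 1%N; (v : nat); sol1 v] j)%:R.

Lemma coord_map_magic : magic_map coord_map.
Proof.
(* Modulo 3, A sends 1 to 6 = 0, the vector v to 0, and y to 1. *)
exists (\row_j (nth 0%N [:: 0; 0; 1]%N j)%:R) => v; apply/rowP => j.
rewrite summxE mxE; under eq_bigr => u _ do rewrite mxE.
rewrite -natr_sum; apply: (mulrn_mod3 _ Z3_exponent).
case: j => [[|[|[|j]]] lt_j] //=; last 2 first.
- exact: nbr_sum_id.
- exact: nbr_sum_sol1.
by rewrite nbr_sum1.
Qed.

Lemma coord_map_generating : generating coord_map.
Proof.
apply/eqP; rewrite eqEsubset subsetT /=; apply/subsetP => x _.
set n := fun j : 'I_3 => (x 0 j : nat).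
pose n0 := n 0; pose n1 := n 1; pose n2 := n 2%:R.
have mem v : coord_map v \in <<[set coord_map u | u : G27]>>%g.
  exact/mem_gen/imset_f.
(* The values at 0, 1, 2 are (1,0,0), (1,1,0), (1,2,1) modulo 3; the exponents solve this triangular
   system, with -1 written as 2. *)
suff -> : x = (coord_map v0 ^+ (n0 + 2 * n1 + n2) * coord_map v1 ^+ (n1 + n2)
               * coord_map v2 ^+ n2)%g by rewrite !groupM ?groupX.
rewrite !FinRing.zmodMgE !FinRing.zmodXgE; apply/rowP => j.
rewrite !mxE !mulmxnE !mxE -!mulrnA -!natrD /=.
(* Only the residue 1 matters; the quotient becomes the variable [h] of [mod2]. *)
have sol12 : sol1 2 = (sol1 2 %/ 3 * 3 + 1)%N by [].
rewrite -[LHS]natr_Zp; apply: (mulrn_mod3 _ Z3_exponent).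
have xE k : j = k -> (x 0 j : nat) = n k by move=> ->.
case: j xE => [[|[|[|j]]] lt_j] xE //=.
- have -> : x 0 (Ordinal lt_j) = n0 :> nat by apply: xE; apply: val_inj.
  by have mod0 a b c :
    (a = 1 * (a + 2 * b + c) + 1 * (b + c) + 1 * c %[mod 3])%N by lia.
- have -> : x 0 (Ordinal lt_j) = n1 :> nat by apply: xE; apply: val_inj.
  by have mod1 a b c :
    (b = 0 * (a + 2 * b + c) + 1 * (b + c) + 2 * c %[mod 3])%N by lia.
- have -> : x 0 (Ordinal lt_j) = n2 :> nat by apply: xE; apply: val_inj.
  have mod2 a b c h :
    (c = 0 * (a + 2 * b + c) + 0 * (b + c) + (h * 3 + 1) * c %[mod 3])%N by lia.
  rewrite sol12; exact: mod2.
Qed.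

(** * The kernel over F_3 modulo constants *)

Lemma pi_cquot_eq0 (R : comNzRingType) (T : finType) (x : {ffun T -> R^o}) :
  (\pi_(cquot R T) x = 0)%qT <-> x \in @const_vec R T.
Proof.
have <- : (\pi_(cquot R T) 0 = 0)%qT.
  by rewrite -(scale0r (0 : {ffun T -> R^o})) pi_cquotZ scale0r.
by rewrite -[X in X \in _]subr0; apply: cquot_eq.
Qed.

Lemma F3_exponent (x : 'F_3) : x *+ 3 = 0.
Proof. by case: x => [[|[|[|m]]] lt_m] //; apply: val_inj. Qed.

Lemma dim_ker_adj_bar :
  \dim (lker (linfun (adj_bar (R := 'F_3) G27_regular))) = 2%N.
Proof.
pose e (F : nat -> nat) : {ffun G27 -> ('F_3)^o} := [ffun v : G27 => (F v)%:R].
pose q F : cquot 'F_3 G27 := (\pi_(cquot 'F_3 G27) (e F))%qT.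
have eP (F : nat -> nat) c :
    (forall v : G27, \sum_(u | adj v u) F u = c %[mod 3])%N ->
    adj_bar G27_regular (q F) = 0.
  move=> Fc; rewrite adj_bar_pi; apply/pi_cquot_eq0/const_vecE => u v.
  rewrite !ffunE; under eq_bigr => w _ do rewrite ffunE.
  under [RHS]eq_bigr => w _ do rewrite ffunE.
  by rewrite -!natr_sum; apply: (mulrn_mod3 _ F3_exponent); rewrite !Fc.
(* [sol1] is not constant, as [v0] and [v2] show; it agrees at [v0] and [v1], where the identity
   differs by 1, so no multiple of it equals the identity up to a constant. *)
have freeq : free [:: q id; q sol1].
  rewrite free_cons seq1_free span_seq1; apply/andP; split; last first.
    apply/eqP => /pi_cquot_eq0/const_vecE/(_ v0 v2)/esym/eqP.
    rewrite !ffunE sol1_v0 (mulrn_mod3 _ F3_exponent _ _ _ sol1_v2).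
    by rewrite oner_eq0.
  apply/vlineP => -[k]; rewrite /q -pi_cquotZ => /cquot_eq/const_vecE.
  move=> /(_ v0 v1)/esym/eqP; rewrite !ffunE sol1_v0 sol1_v1 scaler0 !subr0.
  by rewrite oner_eq0.
suff -> : lker (linfun (adj_bar (R := 'F_3) G27_regular)) =
          <<[:: q id; q sol1]>>%VS by exact/eqP.
apply/eqP; rewrite eqEsubv; apply/andP; split; last first.
  apply/span_subvP => x; rewrite !inE memv_ker lfunE /= => /orP[]/eqP->.
    by rewrite (eP _ _ nbr_sum_id).
  by rewrite (eP _ _ nbr_sum_sol1).
(* A class in the kernel has a representative x with A x constant, that is, a magic map; in its
   coordinate formula the term [x v0] dies in the quotient. *)
apply/subvP; elim/quotW => x; rewrite memv_ker lfunE /= => /eqP.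
rewrite adj_bar_pi => /pi_cquot_eq0/const_vecE xc.
have [c /(magic_map_coords _ F3_exponent) xE] :
    exists c, forall v, \sum_(u | adj v u) x u = c.
  by exists (adj_op x v0) => v; rewrite (xc v0 v) ffunE.
have -> : (\pi_(cquot 'F_3 G27) x)%qT = (x v1 - x v0) *: q id + c *: q sol1.
  rewrite -!pi_cquotZ -pi_cquotD; apply/cquot_eq/const_vecE.
  have combE a b (y z : {ffun G27 -> ('F_3)^o}) u :
    (x - (a *: y + b *: z)) u = x u - (a * y u + b * z u) by rewrite !ffunE.
  have eE F (u : G27) : e F u = (F u)%:R by rewrite ffunE.
  have E u : (x - ((x v1 - x v0) *: e id + c *: e sol1)) u = x v0.
    by rewrite combE !eE !mulr_natr (xE u) -[x v0 + _ + _]addrA addrK.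
  by move=> u v; rewrite !E.
by rewrite memvD ?memvZ ?memv_span ?inE ?eqxx ?orbT.
Qed.

Theorem theorem4p2 :
  exists (G : sgraph) (regG : regular G 6%N),
    #|G| = 27%N /\
    distance_magic G /\
    \dim (lker (linfun (adj_bar (R := 'F_3) regG))) = 2%N /\
    (exists f : G -> 'rV['Z_3]_3, magic_map f /\ generating f) /\
    ~ (exists f : G -> 'rV['Z_3]_3, magic_map f /\ affinely_generating f) /\
    ~ Gamma_distance_magic G 'rV['Z_3]_3 /\
    ~ group_distance_magic G.
Proof.
have cardV : #|'rV['Z_3]_3| = 27%N by rewrite card_mx card_ord.
have not_aff : ~ (exists f : G27 -> 'rV['Z_3]_3,
    magic_map f /\ affinely_generating f).
  case=> f [fm]; apply: not_affinely_generating fm; last by rewrite cardV.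
  exact: Z3_row_exponent.
have not_magic : ~ Gamma_distance_magic G27 'rV['Z_3]_3.
  case=> f [bij_f fm]; apply: not_aff; exists f; split=> //.
  exact: bijective_affinely_generating.
exists G27, G27_regular; do !split=> //.
- exact: card_G27.
- exact: G27_distance_magic.
- exact: dim_ker_adj_bar.
- exists coord_map; split; [exact: coord_map_magic|].
  exact: coord_map_generating.
- by move/(_ 'rV['Z_3]_3); rewrite cardV card_G27 => /(_ erefl).
Qed.
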